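(* Let $\epsilon>0$. Let $X\subseteq\mathbb{R}^n$ be compact, let $Y\subseteq\mathbb{R}^n$ be a convex set containing $X$, and let $\phi:Y\to\mathbb{R}_+$, $\phi(x)=\sum_{i=1}^n\phi_i(x_i)$, be a separable concave function whose components $\phi_i$ are nonnegative. Assume that the problem $Z^*_{\mathrm{conc}}=\min\{\phi(x):x\in X\}$ has an optimal solution $x^*=(x_1^*,\dots,x_n^* )$, bounds $\alpha_i,\beta_i$ with $[\alpha_i,\beta_i]\subseteq\mathrm{proj}_{x_i}Y$, and bounds $l_i,u_i$ with $0<l_i\le u_i$, such that $$x_i^*\in\{\alpha_i,\beta_i\}\cup\bigl([\alpha_i+l_i,\alpha_i+u_i]\cap[\beta_i-u_i,\beta_i-l_i]\bigr)\qquad\text{for } i\in\{1,\dots,n\}.$$ Let $\psi=\sum_{i=1}^n\psi_i$ be the piecewise-linear function constructed from $\phi$, $(\alpha_i),(\beta_i),(l_i),(u_i)$ and $\epsilon$ as described in the context, and let $Z^*_{\mathrm{pwl}}=\min\{\psi(x):x\in X\}$. Then $$Z^*_{\mathrm{conc}}\le Z^*_{\mathrm{pwl}}\le(1+\epsilon)Z^*_{\mathrm{conc}}.$$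
   Context: $\mathrm{proj}_{x_i}Y$ is the projection of $Y$ on the $i$-th coordinate; it is the domain of the concave function $\phi_i$. $X$ need not be convex or connected. ''Slope'' of $\phi_i$ at a point means its derivative, or the right derivative where the derivative does not exist; the tangent at a point is the line through that point of the graph with that slope. Standing assumption: for each $i$ the interval $[\alpha_i+l_i,\alpha_i+u_i]\cap[\beta_i-u_i,\beta_i-l_i]$ is nonempty. Construction of $\psi_i$. Let $l_i'=\max\{l_i,\beta_i-u_i-\alpha_i\}$, $u_i'=\min\{u_i,\beta_i-l_i-\alpha_i\}$ and $q=1+4\epsilon+4\epsilon^2$. (Tangents from the left.) If the slope of $\phi_i$ at $\alpha_i+l_i'$ is nonnegative, introduce tangents to $\phi_i$ at $\alpha_i+l_i'q^k$ for $k=0,\dots,Q_i$, where $Q_i$ is the largest integer such that $\alpha_i+l_i'q^{Q_i}\le\alpha_i+u_i'$ and the slope at $\alpha_i+l_i'q^{Q_i}$ is nonnegative. Let $\zeta_i=\min\{\alpha_i+u_i',\alpha_i+l_i'q^{Q_i+1}\}$. If the slope at $\zeta_i$ is nonnegative, introduce an additional tangent at $\zeta_i$; otherwise let $r_i$ be the largest integer such that the slope at $\alpha_i+l_i'q^{Q_i}(1+\epsilon)^{r_i}$ is nonnegative, and introduce an additional tangent at that point. If the slope at $\alpha_i+l_i'$ is negative, no tangents are introduced from the left. (Tangents from the right.) Symmetrically, if the slope at $\beta_i-l_i'$ is nonpositive, introduce tangents at $\beta_i-l_i'q^k$ for $k=0,\dots,R_i$, where $R_i$ is the largest integer such that $\beta_i-l_i'q^{R_i}\ge\beta_i-u_i'$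 and the slope at $\beta_i-l_i'q^{R_i}$ is nonpositive. Let $\eta_i=\max\{\beta_i-u_i',\beta_i-l_i'q^{R_i+1}\}$. If the slope at $\eta_i$ is nonpositive, introduce an additional tangent at $\eta_i$; otherwise let $t_i$ be the largest integer such that the slope at $\beta_i-l_i'q^{R_i}(1+\epsilon)^{t_i}$ is nonpositive, and introduce an additional tangent at that point. If the slope at $\beta_i-l_i'$ is positive, no tangents are introduced from the right. (Endpoints.) For each of $\alpha_i,\beta_i$ lying in the interior of $\mathrm{proj}_{x_i}Y$, introduce one more tangent at that point. For each of $\alpha_i,\beta_i$ that is an endpoint of $\mathrm{proj}_{x_i}Y$, set $\psi_i$ equal to $\phi_i$ at that point. At all other points of $\mathrm{proj}_{x_i}Y$, $\psi_i(x_i)$ is the minimum of the values at $x_i$ of all introduced tangent lines. Finally $\psi(x)=\sum_{i=1}^n\psi_i(x_i)$. *)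

(* Defs.v *)
From mathcomp Require Import all_boot all_order all_algebra.
From mathcomp Require Import all_classical all_reals all_analysis.

Set Implicit Arguments.
Unset Strict Implicit.
Unset Printing Implicit Defensive.

Import Order.TTheory GRing.Theory Num.Theory numFieldNormedType.Exports.

Local Open Scope classical_set_scope.
Local Open Scope ring_scope.

Definition coord_proj (R : realType) (n : nat) (i : 'I_n) (Y : set 'rV[R]_n) :
  set R := [set x ord0 i | x in Y].

Definition concave_function (R : realType) (D : set R) (f : R -> R) : Prop :=
  convex_function (E := R^o) D (fun x => - f x).

Definition separable_sum (R : realType) (n : nat) (f : 'I_n -> R -> R)
  (x : 'rV[R]_n) : R := \sum_(i < n) f i (x ord0 i).

Definition is_min (R : realType) (T : Type) (f : T -> R) (X : set T) (z : R) :
  Prop := (f @` X) z /\ lbound (f @` X) z.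

Definition right_derivative (R : realType) (f : R -> R) (p : R) : R :=
  lim (h^-1 * (f (p + h) - f p) @[h --> 0^'+]).

Definition slope (R : realType) (f : R -> R) (p : R) : R :=
  if `[< derivable f p 1 >] then 'D_1 f p else right_derivative f p.

(* A function with domain [D] is represented by a total [f : R -> R] whose
   values off [D] are irrelevant, so its slope is meaningful only in the
   interior of [D]; sign conditions on the slope include this membership. *)
Definition slope_ge0 (R : realType) (D : set R) (f : R -> R) (p : R) : Prop :=
  D° p /\ 0 <= slope f p.

Definition slope_le0 (R : realType) (D : set R) (f : R -> R) (p : R) : Prop :=
  D° p /\ slope f p <= 0.

Definition tangent (R : realType) (f : R -> R) (p x : R) : R :=
  f p + slope f p * (x - p).

(* Equal to 0 if [A] is empty or unbounded.  Below, whenever a value of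
   [largest] is used, 0 belongs to [A], so that the largest natural number in
   [A] is also the largest integer satisfying the same condition. *)
Definition largest (A : set nat) : nat := xget 0%N (A `&` ubound A).

Definition grid_ratio (R : realType) (eps : R) : R :=
  1 + 4 * eps + 4 * eps ^+ 2.

(* In the next two definitions [l] and [u] stand for the tightened bounds
   [tight_l] and [tight_u] below. *)
Definition left_tangent_points (R : realType) (eps : R) (D : set R)
    (f : R -> R) (alpha l u : R) : seq R :=
  let q := grid_ratio eps in
  let Q := largest [set k | alpha + l * q ^+ k <= alpha + u
                            /\ slope_ge0 D f (alpha + l * q ^+ k)] in
  let zeta := Num.min (alpha + u) (alpha + l * q ^+ Q.+1) in
  let r := largest
    [set k | slope_ge0 D f (alpha + l * q ^+ Q * (1 + eps) ^+ k)] in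
  if `[< slope_ge0 D f (alpha + l) >] then
    rcons [seq alpha + l * q ^+ k | k <- iota 0 Q.+1]
      (if `[< slope_ge0 D f zeta >] then zeta
       else alpha + l * q ^+ Q * (1 + eps) ^+ r)
  else [::].

Definition right_tangent_points (R : realType) (eps : R) (D : set R)
    (f : R -> R) (beta l u : R) : seq R :=
  let q := grid_ratio eps in
  let N := largest [set k | beta - u <= beta - l * q ^+ k
                            /\ slope_le0 D f (beta - l * q ^+ k)] in
  let eta := Num.max (beta - u) (beta - l * q ^+ N.+1) in
  let t := largest
    [set k | slope_le0 D f (beta - l * q ^+ N * (1 + eps) ^+ k)] in
  if `[< slope_le0 D f (beta - l) >] then
    rcons [seq beta - l * q ^+ k | k <- iota 0 N.+1]
      (if `[< slope_le0 D f eta >] then eta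
       else beta - l * q ^+ N * (1 + eps) ^+ t)
  else [::].

Definition tight_l (R : realType) (alpha beta l u : R) : R :=
  Num.max l (beta - u - alpha).

Definition tight_u (R : realType) (alpha beta l u : R) : R :=
  Num.min u (beta - l - alpha).

Definition tangent_points (R : realType) (eps : R) (D : set R) (f : R -> R)
    (alpha beta l u : R) : seq R :=
  let l' := tight_l alpha beta l u in
  let u' := tight_u alpha beta l u in
  left_tangent_points eps D f alpha l' u'
  ++ right_tangent_points eps D f beta l' u'
  ++ [seq p <- [:: alpha; beta] | `[< D° p >]].

(* Minimum at [x] of the tangents at the points of [s], for [s] nonempty. *)
Definition min_tangents (R : realType) (f : R -> R) (s : seq R) (x : R) : R :=
  \big[Num.min/tangent f (head 0 s) x]_(p <- s) tangent f p x.

(* A point of the interval [D] is an endpoint of [D] iff it is not interior. *)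
Definition pwl (R : realType) (eps : R) (D : set R) (f : R -> R)
    (alpha beta l u : R) (x : R) : R :=
  if (x \in [:: alpha; beta]) && ~~ `[< D° x >] then f x
  else min_tangents f (tangent_points eps D f alpha beta l u) x.

(* Main.v *)
(* Each [psi_i] dominates [phi_i], because the slope of a concave function at
   an interior point is a supergradient.  In the other direction it suffices
   that [psi_i <= (1 + eps) phi_i] at [x*_i].  If the slope there is
   nonnegative, [x*_i] lies, up to a factor [1 + eps], between two consecutive
   tangent points from the left, whose distances from [alpha_i] have ratio at
   most [(1 + 2 eps)^2]; there the smaller of the two tangents is within
   [1 + eps] of the chord.  A nonpositive slope is the mirror image: only the
   supergradient inequality is used, never the one-sidedness of the slope, so
   reflection at [beta_i] is harmless.  Finally [psi] can jump only downwards,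
   at endpoints of the domains, hence is lower semicontinuous and attains its
   minimum on the compact set [X]. *)
Require Import Defs.
From mathcomp Require Import all_boot all_order all_algebra.
From mathcomp Require Import all_classical all_reals all_analysis.
From mathcomp Require Import ring lra.

Set Implicit Arguments.
Unset Strict Implicit.
Unset Printing Implicit Defensive.

Import Order.TTheory GRing.Theory Num.Theory numFieldNormedType.Exports.
Local Open Scope classical_set_scope.
Local Open Scope ring_scope.

(** * Concavity: chords, supergradients and the estimate from two tangents *)

Lemma concave_chord (R : realType) (D : set R) (f : R -> R) (x y z : R) :
  concave_function D f -> D x -> D z -> x < y < z ->
  f x * (z - y) + f z * (y - x) <= f y * (z - x).
Proof.
move=> cf Dx Dz /andP[xy yz].
have xz : 0 < z - x by lra.
have p0 : 0 <= (z - y) / (z - x) by rewrite divr_ge0//; lra.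
have p1 : (z - y) / (z - x) <= 1 by rewrite ler_pdivrMr//; lra.
have xz0 : z - x != 0 by rewrite gt_eqF.
have E : (z - y) / (z - x) * x + (1 - (z - y) / (z - x)) * z = y by field.
have H : - f y <= (z - y) / (z - x) * - f x + (1 - (z - y) / (z - x)) * - f z.
  by rewrite -{1}E; exact: cf (Itv01 p0 p1) x z (mem_set Dx) (mem_set Dz).
move: H; rewrite -(ler_pM2r xz).
rewrite [leRHS](_ : _ = - (f x * (z - y) + f z * (y - x))); last by field.
by rewrite mulNr lerN2.
Qed.

Lemma slope_right_derivative (R : realType) (f : R -> R) (p : R) :
  slope f p = right_derivative f p.
Proof.
rewrite /slope; case: asboolP => // df.
rewrite /derive /right_derivative.
rewrite (_ : (fun h => h^-1 * _) =
  (fun h => h^-1 *: ((f \o shift p) (h *: (1 : R^o)) - f p))).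
  exact: cvg_at_rightE.
by apply/funext => h /=; rewrite addrC [in RHS]/GRing.scale /= mulr1 addrC (addrC p).
Qed.

(** The right difference quotients at [p] increase as the step shrinks and are bounded by chord
    slopes to the left of [p]. Hence their limit exists and separates the chord slopes on the two
    sides. *)
Lemma slope_supergradient (R : realType) (D : set R) (f : R -> R) (p y : R) :
  concave_function D f -> D° p -> D y ->
  f y <= f p + slope f p * (y - p).
Proof.
move=> cf /= Dp Dy; have /nbhs_ballP[e /= e0 eD] := Dp.
have Da : D (p - e / 2) by apply: eD; rewrite /ball /= ltr_norml; lra.
have Db (h : R) : 0 < h < e / 2 -> D (p + h).
  by move=> ?; apply: eD; rewrite /ball /= ltr_norml; lra.
have {}Dp : D p by apply: eD; exact: ballxx.
pose k h := h^-1 * (f (p + h) - f p).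
have kle x (h : R) : D x -> x < p -> 0 < h < e / 2 -> k h * (p - x) <= f p - f x.
  move=> Dx xp he; have /andP[h0 _] := he.
  have := @concave_chord _ D f x p (p + h) cf Dx (Db _ he).
  rewrite xp ltrDl h0 => /(_ isT) H; rewrite -(ler_pM2l h0) /k !mulrA mulfV ?gt_eqF//.
  lra.
have kmono (h1 : R) z : D z -> 0 < h1 -> p + h1 < z -> f z - f p <= k h1 * (z - p).
  move=> Dz h10 pz.
  have := @concave_chord _ D f p (p + h1) z cf Dp Dz.
  rewrite ltrDl h10 pz => /(_ isT) H.
  rewrite -(ler_pM2l h10) /k !mulrA mulfV ?gt_eqF//; lra.
(* [lim] has meaning only once convergence is known; the upper bound comes from the chord over
   [[p - e / 2, p]]. *)
have cvgk : cvg (k h @[h --> 0^'+]).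
  apply/cvg_ex; eexists; apply: (@nonincreasing_at_right_cvgr _ k 0 (BLeft (e / 2))).
  - by rewrite bnd_simp; lra.
  - move=> h1 h2; rewrite !in_itv/= => h1e h2e; rewrite le_eqVlt => /predU1P[->//|h12].
    have := kmono h1 (p + h2) (Db _ h2e); rewrite ltrD2l h12.
    have -> : p + h2 - p = h2 by ring.
    case/andP: h1e => -> _ /(_ isT isT).
    by rewrite -ler_pdivrMr ?(mulrC _ h2^-1)//; case/andP: h2e.
  - exists ((f p - f (p - e / 2)) / (e / 2)) => _ [h /= + <-]; rewrite in_itv/= => he.
    rewrite ler_pdivlMr ?divr_gt0//.
    have := kle _ _ Da _ he; have -> : p - (p - e / 2) = e / 2 by ring.
    by apply; lra.
rewrite slope_right_derivative -lerBlDl.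
have [py|yp|->] := ltgtP p y; last by rewrite !subrr mulr0.
- rewrite -ler_pdivrMr ?subr_gt0//; apply: limr_ge => //.
  near=> h; rewrite ler_pdivrMr ?subr_gt0//; apply: kmono => //.
  rewrite -ltrBrDl; near: h; apply: nbhs_right_lt; lra.
- have : right_derivative f p <= (f p - f y) / (p - y).
    apply: limr_le => //; near=> h; rewrite ler_pdivlMr ?subr_gt0//.
    apply: kle => //; apply/andP; split => //; near: h.
    by apply: nbhs_right_lt; lra.
  rewrite ler_pdivlMr ?subr_gt0// => H.
  by rewrite -(opprB p y) mulrN; lra.
Unshelve. all: by end_near.
Qed.

(* With [t = (m - A) / A], the chord gives [F >= A (1 + t^2 / (q - 1))] where
   [q = grid_ratio eps], and the choice of [q] makes
   [(1 + eps) (1 + t^2 / (q - 1)) - (1 + t)] the square [(t - 2 eps)^2 / (4 eps)]. *)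
Lemma two_tangent_bound (R : realType) (eps a b w A B F sa sw m : R) :
  0 < eps -> 0 < a -> a <= w <= b -> b <= a * grid_ratio eps ->
  sa * a <= A -> A <= F + sw * (a - w) -> B <= F + sw * (b - w) ->
  0 <= F -> 0 <= sw -> m <= A + sa * (w - a) -> m <= B ->
  m <= (1 + eps) * F.
Proof.
move=> e0 a0 /andP[aw wb] bq saA AF BF F0 sw0 mA mB.
have swaw : sw * (a - w) <= 0 by rewrite mulr_ge0_le0//; lra.
have F1 : F <= (1 + eps) * F by rewrite ler_peMl//; lra.
have [mlA|Am] := leP m A; first by lra.
(* [saA] says that the tangent at [a] is nonnegative at 0, so its slope is at most [A / a]. *)
have tan : a * (m - A) <= A * (w - a).
  have : sa * a * (w - a) <= A * (w - a) by rewrite ler_wpM2r//; lra.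
  have : a * (m - A) <= a * (sa * (w - a)) by rewrite ler_pM2l//; lra.
  lra.
have wa : a < w.
  rewrite lt_neqAle aw andbT; apply/eqP => wa.
  by move: mA; rewrite wa subrr mulr0; lra.
have A0 : 0 < A.
  rewrite ltNge; apply/negP => A0.
  have : A * (w - a) <= 0 by rewrite mulr_le0_ge0//; lra.
  have : 0 < a * (m - A) by rewrite mulr_gt0//; lra.
  lra.
(* Weighting the bounds on [A] and [B] by [b - w] and [w - a] makes the [sw] terms cancel. *)
have chord : A * (b - w) + m * (w - a) <= F * (b - a).
  have : A * (b - w) <= (F + sw * (a - w)) * (b - w) by rewrite ler_wpM2r//; lra.
  have : m * (w - a) <= (F + sw * (b - w)) * (w - a).
    by rewrite ler_wpM2r//; lra.
  lra.
have e1 : 0 < 4 * eps * (1 + eps) by rewrite !mulr_gt0//; lra.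
have ba : b - a <= a * (4 * eps * (1 + eps)).
  by move: bq; rewrite /grid_ratio; lra.
have FA : 0 <= F - A by lra.
(* [chord] bounds [(m - A) * (w - a)]; [tan] then trades [w - a] for [a * (m - A) / A], which
   eliminates the positions. *)
have key : (m - A) ^+ 2 <= (F - A) * A * (4 * eps * (1 + eps)).
  have h1 : (m - A) * (w - a) <= (F - A) * (b - a) by lra.
  have h2 : (F - A) * (b - a) <= (F - A) * (a * (4 * eps * (1 + eps))).
    by rewrite ler_wpM2l.
  rewrite -(ler_pM2l a0).
  have h3 : (m - A) * (a * (m - A)) <= (m - A) * (A * (w - a)).
    by rewrite ler_wpM2l//; lra.
  have h4 : A * ((m - A) * (w - a)) <= A * ((F - A) * (a * (4 * eps * (1 + eps)))).
    by rewrite ler_pM2l//; lra.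
  lra.
have := sqr_ge0 (m - A - 2 * eps * A).
have -> : (m - A - 2 * eps * A) ^+ 2
  = (m - A) ^+ 2 - 4 * eps * A * (m - A) + 4 * eps * A * (eps * A) by ring.
have eA : 0 < 4 * eps * A by rewrite !mulr_gt0//; lra.
move=> sq; rewrite -(ler_pM2l eA); lra.
Qed.

(** * Geometric grids of tangent points, measured from one end of the interval *)

Lemma largest_spec (A : set nat) :
  A 0%N -> has_ubound A -> A (largest A) /\ ubound A (largest A).
Proof.
move=> A0 [M AM].
have exA : exists k, `[< A k >] by exists 0%N; exact/asboolP.
have bA k : `[< A k >] -> (k <= M)%N by move=> /asboolP /AM; rewrite leEnat.
have [k /asboolP Ak kmax] := ex_maxnP exA bA.
apply: (@xgetPex _ 0%N (A `&` ubound A)); exists k; split => // j Aj.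
by rewrite leEnat; apply: kmax; exact/asboolP.
Qed.

Lemma expr_unbounded (R : realType) (q M : R) : 1 < q ->
  exists N, forall k, (N <= k)%N -> M < q ^+ k.
Proof.
move=> q1; have q0 : 0 < q by lra.
have : `|q^-1| < 1 by rewrite ger0_norm ?invr_ge0 ?ltW// invf_lt1.
move=> /cvg_expr /cvgrPdist_lt /(_ (`|M| + 1)^-1).
rewrite invr_gt0 ltr_wpDl// => /(_ isT) [N _ HN]; exists N => k /HN /=.
rewrite sub0r normrN exprVn ger0_norm ?invr_ge0 ?exprn_ge0 ?ltW//.
rewrite ltf_pV2 ?posrE ?exprn_gt0 ?ltr_wpDl// => H.
by apply: le_lt_trans H; rewrite (le_trans (ler_norm _))// lerDl.
Qed.

Lemma has_ubound_geometric (R : realType) (l q u : R) (A : set nat) :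
  0 < l -> 1 < q -> (forall k, A k -> l * q ^+ k <= u) -> has_ubound A.
Proof.
move=> l0 q1 Au; have [N HN] := expr_unbounded (u / l) q1.
exists N => k /Au; rewrite leEnat; apply: contraTT; rewrite -ltnNge -ltNge => Nk.
by rewrite mulrC -ltr_pdivrMr// HN// ltnW.
Qed.

(** The slope [s] is left abstract so that the negated slope of a reflected function qualifies as
    well. *)
Definition supergradient (R : realType) (D I : set R) (f s : R -> R) : Prop :=
  forall p v, I p -> D v -> f v <= f p + s p * (v - p).

(** Add the supergradient inequalities at [p] and at [v]. *)
Lemma supergradient_antitone (R : realType) (D I : set R) (f s : R -> R)
    (p v : R) : I `<=` D -> supergradient D I f s -> I p -> I v -> p <= v ->
  s v <= s p.
Proof.
move=> ID fs Ip Iv; rewrite le_eqVlt => /predU1P[->//|pv].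
have := fs _ _ Ip (ID _ Iv); have := fs _ _ Iv (ID _ Ip) => h1 h2.
have vp : 0 < v - p by lra.
rewrite -(ler_pM2r vp); lra.
Qed.

(* Distances from [alpha] (resp. [beta]) of the tangent points introduced from
   the left (resp. right); [G] is the sign condition on the slope. *)
Definition grid_offsets (R : realType) (eps : R) (G : set R) (l u : R) : seq R :=
  let q := grid_ratio eps in
  let Q := largest [set k | l * q ^+ k <= u /\ G (l * q ^+ k)] in
  let zeta := Num.min u (l * q ^+ Q.+1) in
  let r := largest [set k | G (l * q ^+ Q * (1 + eps) ^+ k)] in
  rcons [seq l * q ^+ k | k <- iota 0 Q.+1]
    (if `[< G zeta >] then zeta else l * q ^+ Q * (1 + eps) ^+ r).

Section grid.
Context (R : realType) (eps l u : R) (D I : set R) (g s : R -> R).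
Hypotheses (eps0 : 0 < eps) (l0 : 0 < l) (ID : I `<=` D).
Hypotheses (luI : forall w, l <= w <= u -> I w) (gs : supergradient D I g s).

Let G : set R := [set w | I w /\ 0 <= s w].
Let q := grid_ratio eps.

Let q1 : 1 < q.
Proof. by rewrite /q /grid_ratio; have := sqr_ge0 eps; have := eps0; lra. Qed.

Let q0 : 0 < q. Proof. exact: lt_trans q1. Qed.

(** The sign condition passes to smaller offsets, so maximality of an exponent becomes a statement
    about positions. *)
Let G_down v w : I v -> G w -> v <= w -> G v.
Proof.
move=> Iv [Iw sw] vw; split => //.
by apply: le_trans sw _; exact: supergradient_antitone gs _ _ _.
Qed.

Let grid_le k j : (k <= j)%N -> l * q ^+ k <= l * q ^+ j.
Proof. by move=> kj; rewrite ler_pM2l// ler_weXn2l// ltW. Qed.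

(** The last point [p] exceeds the last grid point by a factor at most [q], and an admissible [w]
    beyond [p] exceeds it by at most [1 + eps]. Both forms of the additional tangent are covered by
    this one description. *)
Lemma grid_offsetsP : l <= u -> G l -> exists Q p,
  [/\ grid_offsets eps G l u = rcons [seq l * q ^+ k | k <- iota 0 Q.+1] p,
      forall k, (k <= Q)%N -> G (l * q ^+ k),
      G p /\ l * q ^+ Q <= p <= l * q ^+ Q * q &
      forall w, w <= u -> G w -> p < w -> w <= p * (1 + eps)].
Proof.
have e1 : 1 <= 1 + eps by rewrite lerDl ltW.
move=> lu Gl; rewrite /grid_offsets -/q.
set AQ := [set k | _ /\ _]; set Q := largest AQ; set zeta := Num.min _ _.
set Ar := [set k | _]; set r := largest Ar.
have AQ0 : AQ 0%N by rewrite /AQ/= expr0 mulr1.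
have [[Qu GQ] Qmax] : AQ Q /\ ubound AQ Q.
  apply: largest_spec => //; apply: (@has_ubound_geometric _ l q u) => //.
  by move=> k [].
have lk k : l <= l * q ^+ k by rewrite ler_peMr ?exprn_ege1 ?ltW.
have GkQ k : (k <= Q)%N -> G (l * q ^+ k).
  move=> kQ; apply: (@G_down _ (l * q ^+ Q)) => //; last exact: grid_le.
  by apply: luI; rewrite lk (le_trans _ Qu)// grid_le.
have zQ : l * q ^+ Q <= zeta by rewrite /zeta le_min Qu grid_le.
have zu : zeta <= u by rewrite /zeta ge_min lexx.
have zq : zeta <= l * q ^+ Q * q by rewrite -mulrA -exprSr /zeta ge_min lexx orbT.
have Iz : I zeta by apply: luI; rewrite zu (le_trans (lk Q)).
exists Q; case: asboolP => Gz.
  exists zeta; split => //; first by split => //; rewrite zQ.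
  move=> w wu Gw; rewrite {1}/zeta gt_min ltNge wu /= => Qw.
  (* Here [zeta] is below [w], hence below [u], so it is the next grid point; admissibility of [w]
     would then make [Q.+1] admissible. *)
  have : AQ Q.+1.
    split; first by rewrite (le_trans (ltW Qw)).
    apply: G_down Gw (ltW Qw); apply: luI.
    by rewrite lk (le_trans (ltW Qw)).
  by move=> /Qmax; rewrite leEnat ltnn.
have gQ0 : 0 < l * q ^+ Q by rewrite (lt_le_trans l0).
(* When [zeta] fails the sign condition, every admissible offset lies before it; this bounds the
   exponents defining [r]. *)
have Glz v : G v -> v <= zeta.
  by move=> Gv; rewrite leNgt; apply/negP => /ltW /(G_down Iz Gv).
have Ar0 : Ar 0%N by rewrite /Ar/= expr0 mulr1.
have [Gr rmax] : Ar r /\ ubound Ar r.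
  apply: largest_spec => //.
  apply: (@has_ubound_geometric _ (l * q ^+ Q) (1 + eps) zeta) => //.
    by rewrite ltrDl.
  by move=> k; exact: Glz.
exists (l * q ^+ Q * (1 + eps) ^+ r); split => //.
  split => //; rewrite (le_trans _ zq) ?Glz// andbT.
  by rewrite (ler_peMr (ltW gQ0))// exprn_ege1.
move=> w wu Gw pw; rewrite leNgt; apply/negP => wp.
(* An admissible [w] beyond the next power of [1 + eps] would make that power admissible too. *)
have : Ar r.+1.
  rewrite /Ar /= exprSr mulrA; apply: G_down Gw (ltW wp).
  apply: luI; rewrite (le_trans (ltW wp))// andbT.
  rewrite (le_trans (lk Q))// -mulrA -exprSr.
  by rewrite (ler_peMr (ltW gQ0))// exprn_ege1.
by move=> /rmax; rewrite leEnat ltnn.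
Qed.

Lemma grid_offsets_sub : l <= u -> G l ->
  {in grid_offsets eps G l u, forall w, G w}.
Proof.
move=> lu Gl w; have [Q [p [-> GQ [Gp _] _]]] := grid_offsetsP lu Gl.
rewrite mem_rcons inE => /predU1P[->//|/mapP[k]].
by rewrite mem_iota add0n ltnS => kQ ->; exact: GQ.
Qed.

(** Either [w] lies between two consecutive points of ratio at most [q], where [two_tangent_bound]
    applies, or it lies beyond the last point, where one tangent suffices. Nonnegativity of [g] at
    offset 0 bounds [s p * p] by [g p]. *)
Lemma grid_offsets_approx (w m : R) : D 0 -> (forall v, D v -> 0 <= g v) ->
  l <= w <= u -> G w ->
  {in grid_offsets eps G l u, forall p, m <= g p + s p * (w - p)} ->
  m <= (1 + eps) * g w.
Proof.
have e0 := eps0; move=> D0 g0 /andP[lw wu] Gw.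
have lu := le_trans lw wu.
have Gl : G l by apply: G_down Gw _ => //; apply: luI; rewrite lexx.
have [Q [p [-> GQ [Gp /andP[Qp pQ]] pmax]]] := grid_offsetsP lu Gl => mP.
have mp : m <= g p + s p * (w - p) by apply: mP; rewrite mem_rcons mem_head.
have mQ k : (k <= Q)%N -> m <= g (l * q ^+ k) + s (l * q ^+ k) * (w - l * q ^+ k).
  move=> kQ; apply: mP; rewrite mem_rcons inE; apply/orP; right.
  by apply/mapP; exists k; rewrite // mem_iota add0n ltnS.
have gw0 : 0 <= g w by apply: g0; apply: ID; case: Gw.
have two a b : 0 < a -> G a -> G b -> a <= w <= b -> b <= a * q ->
    m <= g a + s a * (w - a) -> m <= g b + s b * (w - b) -> m <= (1 + eps) * g w.
  move=> a0 [Ia sa] [Ib sb] awb bq ma mb.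
  apply: (@two_tangent_bound _ eps a b w (g a) (g b) (g w) (s a) (s w)) => //.
  - by have := gs Ia D0; have := g0 _ D0; lra.
  - by apply: gs; [case: Gw|exact: ID].
  - by apply: gs; [case: Gw|exact: ID].
  - by case: Gw.
  - apply: le_trans mb _; rewrite gerDl mulr_ge0_le0//.
    by case/andP: awb; lra.
have gk0 k : 0 < l * q ^+ k by rewrite mulr_gt0// exprn_gt0.
(* Beyond [p] the tangent there rises by at most [eps * (s p * p)], hence by at most [eps * g p],
   and [g p <= g w]. *)
have [wp|pw] := leP w p; last first.
  have [[Ip sp] [Iw sw]] := (Gp, Gw).
  have gp : s p * p <= g p by have := gs Ip D0; have := g0 _ D0; lra.
  have gpw : g p <= g w.
    apply: le_trans (gs Iw (ID Ip)) _; rewrite gerDl mulr_ge0_le0//; lra.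
  have : s p * (w - p) <= s p * (p * eps).
    by rewrite ler_wpM2l//; have := pmax _ wu Gw pw; lra.
  have : eps * (s p * p) <= eps * g p by rewrite ler_pM2l.
  have : eps * g p <= eps * g w by rewrite ler_pM2l.
  lra.
have [wQ|Qw] := leP w (l * q ^+ Q); last first.
  by apply: (two (l * q ^+ Q) p) => //; [exact: GQ|rewrite ltW|exact: mQ].
(* The least grid point at or above [w] and its predecessor enclose [w]; index 0 has no predecessor
   and forces [w = l]. *)
have {wp}: exists k, (k <= Q)%N && (w <= l * q ^+ k) by exists Q; rewrite leqnn.
move=> /ex_minnP[[|k] /andP[kQ wk] kmin].
  have wl : w = l by apply/eqP; rewrite eq_le lw andbT; move: wk; rewrite expr0 mulr1.
  have := mQ 0%N (leq0n _); rewrite expr0 mulr1 wl subrr mulr0 addr0 => /le_trans.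
  by apply; rewrite -wl ler_peMl//; lra.
apply: (two (l * q ^+ k) (l * q ^+ k.+1)) => //.
- by apply: GQ; exact: ltnW.
- exact: GQ.
- rewrite wk andbT leNgt; apply/negP => /ltW wk'.
  by have := kmin k; rewrite wk' (ltnW kQ) ltnn => /(_ isT).
- by rewrite exprSr mulrA.
- by apply: mQ; exact: ltnW.
- exact: mQ.
Qed.

End grid.

(** * Lower semicontinuity and attainment of the minimum *)

(** The near-minimal sublevel sets generate a proper filter on [X]. At a cluster point the value
    cannot exceed the infimum, since a neighbourhood would then miss one of these sets. *)
Lemma compact_lsc_min (R : realType) (T : topologicalType) (X : set T)
    (f : T -> R) :
  compact X -> X !=set0 -> has_lbound (f @` X) ->
  (forall x m, X x -> m < f x -> \forall y \near x, X y -> m < f y) ->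
  exists2 x, X x & forall y, X y -> f x <= f y.
Proof.
move=> cX [x0 Xx0] lbf lscf.
have infX : has_inf (f @` X) by split=> //; exists (f x0), x0.
pose sub e := X `&` [set y | f y < inf (f @` X) + e].
have sub_ne e : 0 < e -> sub e !=set0.
  by move=> /inf_adherent /(_ infX)[_ [y Xy <-] fy]; exists y.
have subF : Filter (filter_from [set e | 0 < e] sub).
  apply: filter_from_filter; first by exists 1 => /=.
  move=> e1 e2 /= e10 e20; exists (Num.min e1 e2) => /=.
    by rewrite lt_min e10 e20.
  move=> y [Xy /= fy]; split; split => //=; apply: lt_le_trans fy _;
    by rewrite lerD2l ge_min lexx ?orbT.
have subPF : ProperFilter (filter_from [set e | 0 < e] sub).
  by apply: filter_from_proper => // e; exact: sub_ne.
have subX : filter_from [set e | 0 < e] sub X by exists 1 => //= y [].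
have [x [Xx clx]] := cX _ subPF subX; exists x => // y Xy.
suff fx : f x <= inf (f @` X).
  by apply: le_trans fx _; apply: ge_inf => //; exists y.
rewrite leNgt; apply/negP => infx.
pose e := (f x - inf (f @` X)) / 2.
have e0 : 0 < e by rewrite divr_gt0// subr_gt0.
have lt_fx : inf (f @` X) + e < f x by rewrite /e; lra.
have Fe : filter_from [set e | 0 < e] sub (sub e) by exists e.
have [z [[Xz /= fz]]] := clx _ _ Fe (lscf _ _ Xx lt_fx).
by move=> /(_ Xz); rewrite ltNge ltW.
Qed.

Lemma separable_sum_lsc (R : realType) (n : nat) (X : set 'rV[R]_n)
    (f : 'I_n -> R -> R) (x : 'rV[R]_n) (m : R) :
  (forall i t c, coord_proj i X t -> c < f i t ->
    \forall v \near t, coord_proj i X v -> c < f i v) ->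
  X x -> m < separable_sum f x ->
  \forall y \near x, X y -> m < separable_sum f y.
Proof.
move=> lscf Xx mx; pose e := (separable_sum f x - m) / n.+1%:R.
have e0 : 0 < e by rewrite divr_gt0 ?subr_gt0.
have /(@filter_forall _ _ _ _ (nbhs_filter x)) : forall i : 'I_n,
    \forall y \near x, X y -> f i (x ord0 i) - e < f i (y ord0 i).
  move=> i; have cx : coord_proj i X (x ord0 i) by exists x.
  have fe : f i (x ord0 i) - e < f i (x ord0 i) by rewrite gtrBl.
  have near_i : \forall y \near x, coord_proj i X ((y : 'rV[R]_n) ord0 i) ->
      f i (x ord0 i) - e < f i (y ord0 i).
    exact: (@coord_continuous R 1 n ord0 i x _ (lscf i _ _ cx fe)).
  by apply: filterS near_i => y /= H Xy; apply: H; exists y.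
move=> near_all; apply: filterS near_all => y H Xy.
apply: (@lt_le_trans _ _ (\sum_(i < n) (f i (x ord0 i) - e))); last first.
  by apply: ler_sum => i _; rewrite ltW// H.
rewrite big_split /= sumrN sumr_const card_ord -/(separable_sum f x).
have -> : e *+ n = separable_sum f x - m - e.
  have : e *+ n.+1 = separable_sum f x - m.
    by rewrite -[LHS]mulr_natr /e divfK// pnatr_eq0.
  by rewrite mulrS => <-; ring.
lra.
Qed.

Lemma min_tangents_le (R : realType) (f : R -> R) (s : seq R) (p x : R) :
  p \in s -> min_tangents f s x <= tangent f p x.
Proof. by move=> ps; exact: ge_bigmin_seq. Qed.

Lemma le_min_tangents (R : realType) (f : R -> R) (s : seq R) (x m : R) :
  s != [::] -> {in s, forall p, m <= tangent f p x} -> m <= min_tangents f s x.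
Proof.
move=> s0 ms; rewrite /min_tangents big_seq le_bigmin//.
by apply: ms; case: s s0 => //= a s _; rewrite mem_head.
Qed.

Lemma min_tangents_lsc (R : realType) (f : R -> R) (s : seq R) (x m : R) :
  m < min_tangents f s x -> \forall y \near x, m < min_tangents f s y.
Proof.
have tangent_lsc p : m < tangent f p x -> \forall y \near x, m < tangent f p y.
  suff /cvgr_gt : tangent f p @ x --> tangent f p x by apply.
  apply: cvgD; first exact: cvg_cst.
  by apply: cvgM; [exact: cvg_cst|apply: cvgB; [exact: cvg_id|exact: cvg_cst]].
rewrite /min_tangents; move: (head 0 s) => p0.
elim: s => [|p s IHs].
  rewrite big_nil => /tangent_lsc mp.
  by apply: filterS mp => y; rewrite big_nil.
rewrite big_cons lt_min => /andP[/tangent_lsc np /IHs ns].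
by apply: filterS2 np ns => y mp ms; rewrite big_cons lt_min mp.
Qed.

(** * One coordinate: tangent points from both sides and the bounds on [pwl] *)

Lemma left_tangent_pointsE (R : realType) (eps : R) (D : set R) (f : R -> R)
    (alpha l u : R) (G := [set w | slope_ge0 D f (alpha + w)]) :
  left_tangent_points eps D f alpha l u =
  if `[< G l >] then [seq alpha + w | w <- grid_offsets eps G l u] else [::].
Proof.
rewrite /left_tangent_points /grid_offsets; case: ifP => // _.
rewrite -addr_minr; under [X in largest X]eq_set do rewrite lerD2l.
by rewrite map_rcons -map_comp; congr (rcons _ _); case: ifP.
Qed.

(** Reflection at [beta] turns the maximum of points into a minimum of offsets and negates the
    slope, so the same grid serves both sides. *)
Lemma right_tangent_pointsE (R : realType) (eps : R) (D : set R) (f : R -> R)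
    (beta l u : R)
    (G := [set w | D° (beta - w) /\ 0 <= - slope f (beta - w)]) :
  right_tangent_points eps D f beta l u =
  if `[< G l >] then [seq beta - w | w <- grid_offsets eps G l u] else [::].
Proof.
have -> : G = [set w | slope_le0 D f (beta - w)].
  by apply/seteqP; split => w []; rewrite /G /slope_le0 /= oppr_ge0.
rewrite /right_tangent_points /grid_offsets; case: ifP => // _.
rewrite -addr_maxr -oppr_min.
under [X in largest X]eq_set do rewrite lerD2l lerN2.
by rewrite map_rcons -map_comp; congr (rcons _ _); case: ifP.
Qed.

(** The tightened interval is symmetric: offsets from [alpha] and from [beta] range over the same
    interval. *)
Lemma tight_bounds (R : realType) (alpha beta l u x : R) :
  0 < l -> alpha + l <= x <= alpha + u -> beta - u <= x <= beta - l ->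
  [/\ 0 < tight_l alpha beta l u,
      tight_u alpha beta l u = beta - alpha - tight_l alpha beta l u &
      tight_l alpha beta l u <= x - alpha <= tight_u alpha beta l u].
Proof.
move=> l0 /andP[? ?] /andP[? ?]; rewrite /tight_l /tight_u; split.
- by rewrite lt_max l0.
- by rewrite oppr_max addr_minr minC; congr (Num.min _ _); ring.
- by rewrite ge_max le_min; apply/andP; split; apply/andP; split; lra.
Qed.

Section coordinate.
Context (R : realType) (eps : R) (D : set R) (f : R -> R).
Context (alpha beta l u x0 : R).
Hypotheses (eps0 : 0 < eps) (cf : concave_function D f).
Hypotheses (f0 : forall t, D t -> 0 <= f t) (abD : [set` `[alpha, beta]] `<=` D).
Hypotheses (l0 : 0 < l) (x0l : alpha + l <= x0 <= alpha + u).
Hypotheses (x0r : beta - u <= x0 <= beta - l).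

Let a := tight_l alpha beta l u.
Let b := tight_u alpha beta l u.

Let a0 : 0 < a. Proof. by have [] := tight_bounds l0 x0l x0r. Qed.

Let bE : b = beta - alpha - a. Proof. by have [] := tight_bounds l0 x0l x0r. Qed.

Let ab : a <= b.
Proof. by have [_ _ /andP[+ +]] := tight_bounds l0 x0l x0r; exact: le_trans. Qed.

Let Dalpha : D alpha.
Proof.
by apply: abD; rewrite /= in_itv/= lexx /=; have := a0; have := ab; rewrite bE; lra.
Qed.

Let Dbeta : D beta.
Proof.
by apply: abD; rewrite /= in_itv/= lexx andbT; have := a0; have := ab; rewrite bE; lra.
Qed.

Let int_ab x : alpha < x < beta -> D° x.
Proof.
move=> xab; apply: (filterS abD).
have : \forall y \near x, y \in `]alpha, beta[ by apply: near_in_itvoo; rewrite in_itv.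
by apply: filterS => y /=; exact: subset_itv_oo_cc.
Qed.

Let supD : supergradient D D° f (slope f).
Proof. by move=> p v Dp Dv; exact: slope_supergradient cf Dp Dv. Qed.

Let IL : set R := [set w | D° (alpha + w)].
Let IR : set R := [set w | D° (beta - w)].
Let GL : set R := [set w | slope_ge0 D f (alpha + w)].
Let GR : set R := [set w | IR w /\ 0 <= - slope f (beta - w)].

Let supL : supergradient [set w | D (alpha + w)] IL
  (fun w => f (alpha + w)) (fun w => slope f (alpha + w)).
Proof.
move=> p v Ip Dv; have := supD Ip Dv.
by have -> : alpha + v - (alpha + p) = v - p by ring.
Qed.

Let supR : supergradient [set w | D (beta - w)] IR
  (fun w => f (beta - w)) (fun w => - slope f (beta - w)).
Proof.
move=> p v Ip Dv; have := supD Ip Dv.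
have -> : beta - v - (beta - p) = - (v - p) by ring.
by rewrite mulrN mulNr.
Qed.

Let abIL w : a <= w <= b -> IL w.
Proof. by move=> wab; apply: int_ab; have := a0; have := bE; have := ab; lra. Qed.

Let abIR w : a <= w <= b -> IR w.
Proof. by move=> wab; apply: int_ab; have := a0; have := bE; have := ab; lra. Qed.

Let subL : IL `<=` [set w | D (alpha + w)].
Proof. by move=> w; exact: interior_subset. Qed.

Let subR : IR `<=` [set w | D (beta - w)].
Proof. by move=> w; exact: interior_subset. Qed.

Let s := tangent_points eps D f alpha beta l u.

Let mem_left w : GL a -> w \in grid_offsets eps GL a b -> alpha + w \in s.
Proof.
move=> GLa wG; rewrite /s /tangent_points mem_cat -/a -/b left_tangent_pointsE.
by rewrite asboolT//; apply/orP; left; exact: map_f.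
Qed.

Let mem_right w : GR a -> w \in grid_offsets eps GR a b -> beta - w \in s.
Proof.
move=> GRa wG; rewrite /s /tangent_points !mem_cat -/a -/b right_tangent_pointsE.
rewrite asboolT//; apply/orP; right; apply/orP; left.
exact: (map_f (fun v => beta - v)).
Qed.

Let Ia : D° (alpha + a). Proof. by apply: abIL; rewrite lexx ab. Qed.

Lemma tangent_points_interior : {in s, forall p, D° p}.
Proof.
move=> p; rewrite /s /tangent_points !mem_cat -/a -/b.
rewrite left_tangent_pointsE right_tangent_pointsE => /or3P[].
- case: asboolP => // GLa /mapP[w wG ->].
  by have [] := grid_offsets_sub eps0 a0 subL abIL supL ab GLa wG.
- case: asboolP => // GRa /mapP[w wG ->].
  by have [] := grid_offsets_sub eps0 a0 subR abIR supR ab GRa wG.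
- by rewrite mem_filter => /andP[/asboolP].
Qed.

(** If the slope at [alpha + a] is negative, it is still negative at [beta - a], which lies no
    further left; so at least one side introduces tangents. *)
Lemma tangent_points_neq_nil : s != [::].
Proof.
have [sl|sl] := leP 0 (slope f (alpha + a)).
  have GLa : GL a by [].
  have := mem_left GLa; rewrite /grid_offsets; case: s => // H.
  by have := H _ (mem_head _ _).
have GRa : GR a.
  have Ib : IR a by apply: abIR; rewrite lexx ab.
  split => //; rewrite oppr_ge0 (le_trans _ (ltW sl))//.
  apply: (supergradient_antitone _ supD) => //; first exact: interior_subset.
  by have := bE; have := ab; lra.
have := mem_right GRa; rewrite /grid_offsets; case: s => // H.
by have := H _ (mem_head _ _).
Qed.

Let pwlf := pwl eps D f alpha beta l u.

Let le_min_tangents_D t : D t -> f t <= min_tangents f s t.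
Proof.
move=> Dt; apply: le_min_tangents; first exact: tangent_points_neq_nil.
by move=> p /tangent_points_interior Dp; exact: slope_supergradient cf Dp Dt.
Qed.

Lemma le_pwl t : D t -> f t <= pwlf t.
Proof. by move=> Dt; rewrite /pwlf /pwl; case: ifP => // _; exact: le_min_tangents_D. Qed.

Let pwl_le_min_tangents t : D t -> pwlf t <= min_tangents f s t.
Proof. by move=> Dt; rewrite /pwlf /pwl; case: ifP => // _; exact: le_min_tangents_D. Qed.

(** The value at [t] is at most the minimum of the tangents, which is lower semicontinuous. Near
    [t], only [t] itself can be an exceptional endpoint. *)
Lemma pwl_lsc t m : D t -> m < pwlf t ->
  \forall v \near t, D v -> m < pwlf v.
Proof.
move=> Dt mt.
have mmin := min_tangents_lsc (lt_le_trans mt (pwl_le_min_tangents Dt)).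
have avoid c : \forall v \near t, v = c -> v = t.
  have [->|tc] := eqVneq t c; first by apply: filterE.
  have nc : \forall v \near t, v != c.
    by apply: open_nbhs_nbhs; split => //; exact: open_neq.
  by apply: filterS nc => v /eqP.
apply: filterS3 mmin (avoid alpha) (avoid beta) => v mv va vb _.
have [<-//|vt] := eqVneq t v.
rewrite /pwlf /pwl; case: ifP => // /andP[+ _].
by rewrite !inE => /orP[] /eqP E; rewrite -?(va E) -?(vb E) eqxx in vt.
Qed.

Lemma pwl_approx t : t = alpha \/ t = beta \/
    (alpha + l <= t <= alpha + u /\ beta - u <= t <= beta - l) ->
  pwlf t <= (1 + eps) * f t.
Proof.
have endpoint c : D c -> c \in [:: alpha; beta] -> pwlf c <= (1 + eps) * f c.
  move=> Dc cab; have fc : f c <= (1 + eps) * f c.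
    by rewrite ler_peMl ?f0// lerDl ltW.
  rewrite /pwlf /pwl cab /=; case: asboolP => //= Ic.
  apply: le_trans fc; have cs : c \in s.
    by rewrite /s /tangent_points !mem_cat mem_filter asboolT// cab !orbT.
  (* At an interior [alpha] or [beta] the tangent introduced at that very point has the value of
     [f]. *)
  by apply: le_trans (min_tangents_le _ _ cs) _; rewrite /tangent subrr mulr0 addr0.
case=> [->|[->|[tl tr]]].
- by apply: endpoint => //; rewrite mem_head.
- by apply: endpoint => //; rewrite !inE eqxx orbT.
have [_ _ tab] := tight_bounds l0 tl tr; rewrite -/a -/b in tab.
have It : D° t by apply: int_ab; have := a0; have := bE; lra.
apply: le_trans (pwl_le_min_tangents (interior_subset It)) _.
have [st|st] := leP 0 (slope f t).
  rewrite -[t in leRHS](subrKC alpha).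
  apply: (grid_offsets_approx eps0 a0 subL abIL supL) => //=.
  - by rewrite addr0.
  - by move=> v; exact: f0.
  - by rewrite /IL /= subrKC.
  move=> p pG; apply: le_trans (min_tangents_le _ _ (mem_left _ pG)) _.
    (* A nonnegative slope at [t] forces one at [alpha + a], so the left tangents are indeed
       present. *)
    have := supergradient_antitone (@interior_subset _ D) supD Ia It.
    move=> H; split => //; apply: le_trans st _; apply: H; lra.
  by rewrite /tangent opprD addrA.
have tE : t = beta - (beta - t) by ring.
have Ib : IR a by apply: abIR; rewrite lexx ab.
rewrite [t in leRHS]tE.
apply: (grid_offsets_approx eps0 a0 subR abIR supR) => //=.
- by rewrite subr0.
- by move=> v; exact: f0.
- by have := bE; lra.
- by rewrite /IR /= -tE oppr_ge0 ltW.
move=> p pG; apply: le_trans (min_tangents_le _ _ (mem_right _ pG)) _.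
  have := supergradient_antitone (@interior_subset _ D) supD It Ib.
  move=> H; split => //; rewrite oppr_ge0; apply: le_trans (ltW st).
  by apply: H; have := bE; lra.
rewrite /tangent mulNr -mulrN.
by have -> : - (beta - t - p) = t - (beta - p) by ring.
Qed.

End coordinate.

(** * Summation over the coordinates *)

Theorem lemma4 (R : realType) (n : nat) (eps : R) (X Y : set 'rV[R]_n)
    (phi : 'I_n -> R -> R) (alpha beta l u : 'I_n -> R)
    (xopt : 'rV[R]_n) (Zconc : R) :
  0 < eps ->
  compact X ->
  convex_set Y ->
  X `<=` Y ->
  (forall i, concave_function (coord_proj i Y) (phi i)) ->
  (forall i t, coord_proj i Y t -> 0 <= phi i t) ->
  is_min (separable_sum phi) X Zconc ->
  X xopt ->
  separable_sum phi xopt = Zconc ->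
  (forall i, [set` `[alpha i, beta i]] `<=` coord_proj i Y) ->
  (forall i, 0 < l i /\ l i <= u i) ->
  (forall i, [set` `[alpha i + l i, alpha i + u i]]
             `&` [set` `[beta i - u i, beta i - l i]] !=set0) ->
  (forall i, ([set alpha i; beta i]
              `|` ([set` `[alpha i + l i, alpha i + u i]]
                   `&` [set` `[beta i - u i, beta i - l i]]))
             (xopt ord0 i)) ->
  let psi := separable_sum (fun i =>
    pwl eps (coord_proj i Y) (phi i) (alpha i) (beta i) (l i) (u i)) in
  exists Zpwl : R,
    is_min psi X Zpwl /\ Zconc <= Zpwl <= (1 + eps) * Zconc.
Proof.
move=> eps0 cX cY XY cphi phi0 [_ Zmin] Xopt ZE abY lu ne xopt_in psi.
(* This point certifies that the tightened bounds are consistent, also in coordinates where the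
   optimal solution sits at [alpha i] or [beta i]. *)
have x0_ex i : exists x, alpha i + l i <= x <= alpha i + u i /\
    beta i - u i <= x <= beta i - l i.
  by have [x []] := ne i; rewrite /= !in_itv/=; exists x.
have XYi i : coord_proj i X `<=` coord_proj i Y by exact: image_subset.
have psi_ge x : X x -> separable_sum phi x <= psi x.
  move=> Xx; apply: ler_sum => i _; have [x0 [? ?]] := x0_ex i.
  by apply: (le_pwl eps0 (cphi i) (abY i) (lu i).1 (x0 := x0)) => //;
    apply: XYi; exists x.
have Zphi x : X x -> Zconc <= separable_sum phi x by move=> Xx; apply: Zmin; exists x.
have [z Xz zmin] : exists2 z, X z & forall y, X y -> psi z <= psi y.
  apply: compact_lsc_min => //.
  - by exists xopt.
  - exists Zconc => _ [x Xx <-]; exact: le_trans (Zphi _ Xx) (psi_ge _ Xx).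
  move=> x m Xx; apply: separable_sum_lsc => // i t c Xt ct.
  have [x0 [? ?]] := x0_ex i.
  have near_t : \forall v \near t, coord_proj i Y v ->
      c < pwl eps (coord_proj i Y) (phi i) (alpha i) (beta i) (l i) (u i) v.
    by apply: (pwl_lsc eps0 (cphi i) (abY i) (lu i).1 (x0 := x0)) ct => //; exact: XYi.
  by apply: filterS near_t => v H /XYi.
exists (psi z); split; first by split; [exists z|move=> _ [y Xy <-]; exact: zmin].
rewrite (le_trans (Zphi _ Xz) (psi_ge _ Xz)) /=.
apply: le_trans (zmin _ Xopt) _.
rewrite -ZE mulr_sumr; apply: ler_sum => i _; have [x0 [? ?]] := x0_ex i.
apply: (pwl_approx eps0 (cphi i) (phi0 i) (abY i) (lu i).1 (x0 := x0)) => //.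
have := xopt_in i; rewrite /= !in_itv/=; tauto.
Qed.
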